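(* Let $S$ be an inverse semigroup with $0$ and $1$, and let $\Phi\subset E(S)$ be a set of mutually equivalent non-zero idempotents. The map $s\mapsto\alpha_s$, $S_\Phi\to PB(\Phi)$, is a semigroup homomorphism.
   Context: $E(S)$ is the set of idempotents of $S$, and $s^*$ is the unique pseudoinverse of $s\in S$. Idempotents $e,f$ are equivalent if there is $s\in S$ with $ss^*=e$ and $s^*s=f$. $S(\Phi)$ is the set of all $s\in S$ such that for every $e\in\Phi$ one of the following holds: either $es^*s=0$; or $es^*s=e$ and then there exists $f\in\Phi$ such that ( * ) $se=fs$ and $fss^*=f$. Such $f$ is unique. Put $S_\Phi=S(\Phi)\cap S(\Phi)^*$, where $R^*=\{s^*:s\in R\}$; it is an inverse subsemigroup of $S$. For a set $Z$, $PB(Z)$ is the inverse semigroup of partial bijections of $Z$, i.e. triples $(A,f,B)$ with $A,B\subset Z$ and $f:A\to B$ a bijection; the product of $(A,f,B)$ and $(C,g,D)$ is the composition $f\circ g$ (apply $g$ first), defined on all $z\in C$ with $g(z)\in A$. For $s\in S_\Phi$ put $A(s)=\{e\in\Phi:es^*s=e\}$, define $\alpha(s):A(s)\to\Phi$ by $\alpha(s)(e)=f$, where $f\in\Phi$ satisfies ( * ), and let $B(s)=\alpha(s)(A(s))$. The map $\alpha(s)$ is a bijection onto $B(s)$, and $\alpha_s=(A(s),\alpha(s),B(s))\in PB(\Phi)$. *)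

(* Defs.v *)
From HB Require Import structures.
From mathcomp Require Import all_boot.
From mathcomp Require Import boolp classical_sets.

Set Implicit Arguments.
Unset Strict Implicit.
Unset Printing Implicit Defensive.

Local Open Scope classical_set_scope.
Local Open Scope group_scope.

HB.mixin Record isInverseSemigroup S of Semigroup S := {
  star : S -> S;
  mulg_star_mulg : forall s : S, s * star s * s = s;
  star_mulg_star : forall s : S, star s * s * star s = star s;
  star_unique : forall s t : S, s * t * s = s -> t * s * t = t -> t = star s
}.

#[short(type="inverseSemigroupType")]
HB.structure Definition InverseSemigroup :=
  {S of isInverseSemigroup S & Semigroup S}.

(* Written [zero] rather than [0]: the library has no multiplicative
   structure with an absorbing element outside semirings. *)
HB.mixin Record hasAbsorbingZero S of Semigroup S := {
  zero : S;
  mul_zerog : forall s : S, zero * s = zero;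
  mulg_zero : forall s : S, s * zero = zero
}.

#[short(type="inverseSemigroup01Type")]
HB.structure Definition InverseSemigroup01 :=
  {S of InverseSemigroup S & Monoid S & hasAbsorbingZero S}.

Definition idempotents (S : semigroupType) : set S := [set e | e * e = e].

Definition idem_equiv (S : inverseSemigroupType) (e f : S) : Prop :=
  exists s : S, s * star s = e /\ star s * s = f.

Section InverseSemigroupTheory.
Variable S : inverseSemigroupType.
Implicit Types s t e f : S.

Lemma starK s : star (star s) = s.
Proof.
by apply/esym/star_unique; [exact: star_mulg_star | exact: mulg_star_mulg].
Qed.

Lemma star_idem e : idempotents e -> star e = e.
Proof. by move=> ee; apply/esym/star_unique; rewrite !ee. Qed.

Lemma idem_mul e f : idempotents e -> idempotents f -> idempotents (e * f).
Proof.
rewrite /idempotents /= => ee ff.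
set x := star (e * f).
have xa : e * f * x * (e * f) = e * f := mulg_star_mulg _.
have xb : x * (e * f) * x = x := star_mulg_star _.
have fxe : f * x * e = x.
  apply: star_unique.
    by rewrite !mulgA -(mulgA e f f) ff -(mulgA _ e e) ee -!mulgA !mulgA
               -(mulgA _ e f) xa.
  have -> : f * x * e * (e * f) * (f * x * e)
          = f * (x * ((e * e) * (f * f)) * x) * e by rewrite !mulgA.
  by rewrite ee ff xb.
have xx : x * x = x.
  rewrite -{1 2}fxe.
  have -> : f * x * e * (f * x * e) = f * (x * (e * f) * x) * e.
    by rewrite !mulgA.
  by rewrite xb.
have -> : e * f = x by rewrite -(star_idem xx) /x starK.
exact: xx.
Qed.

Lemma idemC e f : idempotents e -> idempotents f -> e * f = f * e.
Proof.
move=> ee ff; have ef := idem_mul ee ff; have fe := idem_mul ff ee.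
have -> : f * e = star (e * f); last by rewrite (star_idem ef).
move: ee ff ef fe; rewrite /idempotents /= => ee ff ef fe.
apply: star_unique.
  have -> : e * f * (f * e) * (e * f) = e * (f * f) * (e * e) * f.
    by rewrite !mulgA.
  by rewrite ee ff -mulgA ef.
have -> : f * e * (e * f) * (f * e) = f * (e * e) * (f * f) * e.
  by rewrite !mulgA.
by rewrite ee ff -mulgA fe.
Qed.

Lemma idem_mulg_star s : idempotents (s * star s).
Proof. by rewrite /idempotents /= mulgA mulg_star_mulg. Qed.

Lemma idem_star_mulg s : idempotents (star s * s).
Proof. by rewrite /idempotents /= mulgA star_mulg_star. Qed.

Lemma starM s t : star (s * t) = star t * star s.
Proof.
have C := idemC (idem_mulg_star t) (idem_star_mulg s).
apply/esym/star_unique.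
  have -> : s * t * (star t * star s) * (s * t)
          = s * ((t * star t) * (star s * s)) * t by rewrite !mulgA.
  rewrite C.
  have -> : s * (star s * s * (t * star t)) * t
          = (s * star s * s) * (t * star t * t) by rewrite !mulgA.
  by rewrite !mulg_star_mulg.
have -> : star t * star s * (s * t) * (star t * star s)
        = star t * ((star s * s) * (t * star t)) * star s by rewrite !mulgA.
rewrite -C.
have -> : star t * (t * star t * (star s * s)) * star s
        = (star t * t * star t) * (star s * s * star s) by rewrite !mulgA.
by rewrite !star_mulg_star.
Qed.

End InverseSemigroupTheory.

Record PB (Z : Type) := MkPB {
  pb_dom : set Z;
  pb_cod : set Z;
  pb_fun : pb_dom -> pb_cod;
  pb_bij : bijective pb_fun
}.

Section PartialBijections.
Variable Z : Type.
Implicit Types p q r : PB Z.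

HB.instance Definition _ := gen_eqMixin (PB Z).
HB.instance Definition _ := gen_choiceMixin (PB Z).

(* The graph of a partial bijection determines it. *)
Definition pb_rel p (x y : Z) : Prop :=
  exists hx : x \in pb_dom p, val (pb_fun (exist _ x hx)) = y.

Lemma pb_rel_fun p (x : pb_dom p) : pb_rel p (val x) (val (pb_fun x)).
Proof.
exists (valP x); congr (val (pb_fun _)); exact: val_inj.
Qed.

Lemma pb_relP p x y : pb_rel p x y ->
  exists x' : pb_dom p, val x' = x /\ val (pb_fun x') = y.
Proof. by case=> hx <-; exists (exist _ x hx). Qed.

Lemma pb_rel_det p x y y' : pb_rel p x y -> pb_rel p x y' -> y = y'.
Proof. by case=> h <- [h' <-]; rewrite (bool_irrelevance h h'). Qed.

Lemma pb_rel_inj p x x' y : pb_rel p x y -> pb_rel p x' y -> x = x'.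
Proof.
move=> /pb_relP[a [<- <-]] /pb_relP[b [<-]] /val_inj/(bij_inj (@pb_bij _ p)).
by move->.
Qed.

Lemma pb_dom_rel p x : pb_dom p x <-> exists y, pb_rel p x y.
Proof.
split=> [/mem_set hx|[y [hx _]]]; last exact: set_mem.
by exists (val (pb_fun (exist _ x hx))), hx.
Qed.

Lemma pb_cod_rel p y : pb_cod p y <-> exists x, pb_rel p x y.
Proof.
split=> [/mem_set hy|[x [hx <-]]]; last exact: set_valP.
have [g fK gK] := pb_bij p.
exists (val (g (exist _ y hy))).
by have := pb_rel_fun (g (exist _ y hy)); rewrite gK.
Qed.

Lemma pb_ext p q : (forall x y, pb_rel p x y <-> pb_rel q x y) -> p = q.
Proof.
move=> pq.
have domE : pb_dom p = pb_dom q.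
  apply/seteqP; split=> x /pb_dom_rel[y xy]; apply/pb_dom_rel; exists y;
  exact/pq.
have codE : pb_cod p = pb_cod q.
  apply/seteqP; split=> y /pb_cod_rel[x xy]; apply/pb_cod_rel; exists x;
  exact/pq.
case: p q pq domE codE => [A B f bf] [C D g bg] /= pq AC BD.
subst C D.
have fg : f = g.
  apply/funext => x; apply/val_inj.
  have /pq := @pb_rel_fun (MkPB bf) x.
  by move/pb_rel_det; apply; exact: (@pb_rel_fun (MkPB bg)).
by subst g; congr MkPB; exact: Prop_irrelevance.
Qed.

(* [val z] for the [z : C] with [g z] in [A]. *)
Definition comp_dom p q : set Z :=
  [set val z | z in [set z : pb_dom q | pb_dom p (val (pb_fun z))]].

Lemma comp_domq p q (z : comp_dom p q) : val z \in pb_dom q.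
Proof. by apply/mem_set; have [x _ <-] := set_valP z; exact: set_valP. Qed.

Lemma comp_domp p q (z : comp_dom p q) :
  val (pb_fun (exist _ (val z) (comp_domq z))) \in pb_dom p.
Proof.
apply/mem_set; have [x /= xp xz] := set_valP z.
by rewrite (_ : exist _ _ _ = x) //; exact: val_inj.
Qed.

Definition comp_val p q (z : comp_dom p q) : Z :=
  val (pb_fun (exist (fun y => y \in pb_dom p) _ (comp_domp z))).

Definition comp_cod p q : set Z := range (@comp_val p q).

Lemma comp_codP p q (z : comp_dom p q) : comp_val z \in comp_cod p q.
Proof. by apply/mem_set; exists z. Qed.

Definition comp_fun p q (z : comp_dom p q) : comp_cod p q :=
  exist _ (comp_val z) (comp_codP z).

Lemma injsurj_bij (T U : Type) (f : T -> U) :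
  injective f -> (forall y, exists x, f x = y) -> bijective f.
Proof.
move=> fI fS; exists (fun y => sval (cid (fS y))) => x.
  by apply: fI; exact: (svalP (cid (fS (f x)))).
exact: (svalP (cid (fS x))).
Qed.

Lemma comp_bij p q : bijective (@comp_fun p q).
Proof.
apply: injsurj_bij.
  move=> x y /(congr1 val) /= /val_inj /(bij_inj (@pb_bij _ p)) /(congr1 val).
  move=> /= /val_inj /(bij_inj (@pb_bij _ q)) /(congr1 val) /= xy.
  exact: val_inj.
by move=> y; have [x _ xy] := set_valP y; exists x; exact: val_inj.
Qed.

Definition pb_mul p q : PB Z := MkPB (@comp_bij p q).

Lemma pb_mul_rel p q x y :
  pb_rel (pb_mul p q) x y <-> exists2 z, pb_rel q x z & pb_rel p z y.
Proof.
split=> [[hx /= <-]|[z [hx xz] [hz zy]]].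
  rewrite /comp_val /=.
  set z := (X in val (pb_fun X)).
  by exists (val z); [eexists; reflexivity | exact: pb_rel_fun].
have hxc : x \in comp_dom p q.
  apply/mem_set; exists (exist _ x hx) => //=; apply: set_mem.
  by rewrite xz.
exists hxc; rewrite /= /comp_val -zy; congr (val (pb_fun _)).
apply/val_inj => /=; rewrite -xz; congr (val (pb_fun _)).
exact: val_inj.
Qed.

Lemma pb_mulA : associative pb_mul.
Proof.
move=> p q r; apply: pb_ext => x y; split.
  move=> /pb_mul_rel[z /pb_mul_rel[w xw wz] zy].
  by apply/pb_mul_rel; exists w => //; apply/pb_mul_rel; exists z.
move=> /pb_mul_rel[w xw /pb_mul_rel[z wz zy]].
by apply/pb_mul_rel; exists z => //; apply/pb_mul_rel; exists w.
Qed.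

HB.instance Definition _ := isSemigroup.Build (PB Z) pb_mulA.

Lemma pb_inv_ex p : exists q, forall x y, pb_rel q x y <-> pb_rel p y x.
Proof.
have [g fK gK] := pb_bij p.
have bg : bijective g by exists (@pb_fun _ p).
exists (MkPB bg) => x y; split=> /pb_relP[a [/= <- <-]].
  by rewrite -[in X in pb_rel _ _ X](gK a); exact: pb_rel_fun.
by rewrite -[in X in pb_rel _ _ X](fK a); exact: (@pb_rel_fun (MkPB bg)).
Qed.

Definition pb_star p : PB Z := sval (cid (pb_inv_ex p)).

Lemma pb_star_rel p x y : pb_rel (pb_star p) x y <-> pb_rel p y x.
Proof. exact: (svalP (cid (pb_inv_ex p))). Qed.

Lemma pb_mul3_rel p q r x y : pb_rel (p * q * r) x y <->
  exists z w, [/\ pb_rel r x z, pb_rel q z w & pb_rel p w y].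
Proof.
split=> [/pb_mul_rel[z xz /pb_mul_rel[w zw wy]]|[z [w [xz zw wy]]]].
  by exists z, w.
by apply/pb_mul_rel; exists z => //; apply/pb_mul_rel; exists w.
Qed.

Lemma pb_mulK p : p * pb_star p * p = p.
Proof.
apply: pb_ext => x y; split=> [|xy].
  by move=> /pb_mul3_rel[z [w [xz /pb_star_rel/(pb_rel_inj xz) <-]]].
by apply/pb_mul3_rel; exists y, x; split=> //; exact/pb_star_rel.
Qed.

Lemma pb_starK p : pb_star (pb_star p) = p.
Proof.
apply: pb_ext => x y; split=> [/pb_star_rel/pb_star_rel|xy] //.
exact/pb_star_rel/pb_star_rel.
Qed.

Lemma pb_mulK' p : pb_star p * p * pb_star p = pb_star p.
Proof. by have := pb_mulK (pb_star p); rewrite pb_starK. Qed.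

Lemma pb_star_unique p q : p * q * p = p -> q * p * q = q -> q = pb_star p.
Proof.
move=> pqp qpq; apply: pb_ext => x y; split=> [xy|/pb_star_rel yx].
  apply/pb_star_rel; have := xy; rewrite -{1}qpq.
  move=> /pb_mul3_rel[z [w [/(pb_rel_det xy) <- yw wy]]].
  by rewrite (pb_rel_inj xy wy).
have := yx; rewrite -{1}pqp.
move=> /pb_mul3_rel[z [w [/(pb_rel_det yx) <- xw wx]]].
by rewrite (pb_rel_inj yx wx).
Qed.

HB.instance Definition _ :=
  isInverseSemigroup.Build (PB Z) pb_mulK pb_mulK' pb_star_unique.

End PartialBijections.

Section SPhi.
Variables (S : inverseSemigroup01Type) (Phi : set S).

Definition equivalent_nonzero_idempotents : Prop :=
  [/\ Phi `<=` @idempotents S,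
      forall e, Phi e -> e <> zero
    & forall e f, Phi e -> Phi f -> idem_equiv e f].

(* The condition relating e to its image f. *)
Definition starred (s e f : S) : Prop :=
  s * e = f * s /\ f * s * star s = f.

Definition pre_SPhi : set S := [set s | forall e, Phi e ->
  e * star s * s = zero \/
  (e * star s * s = e /\ exists f, Phi f /\ starred s e f)].

Definition SPhi : set S := pre_SPhi `&` (@star S @` pre_SPhi).

Hypothesis hPhi : equivalent_nonzero_idempotents.

Lemma pre_SPhiM s t : pre_SPhi s -> pre_SPhi t -> pre_SPhi (s * t).
Proof.
move=> hs ht e Pe; have [PhiE _ _] := hPhi.
have ie : idempotents e by exact: PhiE.
have reassoc : e * star (s * t) * (s * t)
             = e * star t * star s * s * t by rewrite starM !mulgA.
have [et0|[ete [f [Pf [tef ftt]]]]] := ht e Pe.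
  left; rewrite reassoc -[in star t](star_mulg_star t).
  have -> : e * (star t * t * star t) * star s * s * t
     = e * star t * t * (star t * star s * s * t) by rewrite !mulgA.
  by rewrite et0 mul_zerog.
have fE : f = t * e * star t by rewrite tef ftt.
have etf : e * star t = star t * f.
  have -> : star t * f = (star t * t) * e * star t by rewrite fE !mulgA.
  rewrite (idemC (idem_star_mulg t) ie).
  by rewrite [e * (star t * t)]mulgA ete.
have [fs0|[fsf [g [Pg [sfg gss]]]]] := hs f Pf.
  left; rewrite reassoc etf -(mulgA (star t)) -(mulgA (star t)) fs0.
  by rewrite mulg_zero mul_zerog.
right; rewrite reassoc.
have fst : e * star t * star s * s * t = e.
  by rewrite etf -(mulgA (star t)) -(mulgA (star t)) fsf -etf.
split=> //; exists g; split=> //; split.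
  by rewrite -mulgA tef mulgA sfg mulgA.
rewrite starM !mulgA -sfg.
have -> : s * f * t * star t * star s = s * (f * t * star t) * star s.
  by rewrite !mulgA.
by rewrite ftt sfg gss.
Qed.

Lemma SPhi_mul s t : SPhi s -> SPhi t -> SPhi (s * t).
Proof.
move=> [hs [s' hs' ss']] [ht [t' ht' tt']]; split; first exact: pre_SPhiM.
by exists (t' * s'); [exact: pre_SPhiM | rewrite starM ss' tt'].
Qed.

Lemma SPhi_star s : SPhi s -> SPhi (star s).
Proof.
move=> [hs [t ht ts]]; split; first by rewrite -ts starK.
by exists s.
Qed.

End SPhi.

(* S_Phi as a type; [hPhi] is what makes it closed under the product. *)
Definition SPhi_type (S : inverseSemigroup01Type) (Phi : set S)
  of equivalent_nonzero_idempotents Phi : Type := SPhi Phi.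

Section Alpha.
Variables (S : inverseSemigroup01Type) (Phi : set S).
Hypothesis hPhi : equivalent_nonzero_idempotents Phi.

Local Notation SP := (SPhi_type hPhi).

HB.instance Definition _ := SubType.copy SP {s : S | s \in SPhi Phi}.
HB.instance Definition _ := [Choice of SP by <:].

Implicit Types s t : SP.

Definition SPhi_tmul s t : SP :=
  exist _ (val s * val t)
    (mem_set (SPhi_mul hPhi (set_valP s) (set_valP t))).

Lemma SPhi_tmulA : associative SPhi_tmul.
Proof. by move=> s t u; apply: val_inj; rewrite /= mulgA. Qed.

HB.instance Definition _ := isSemigroup.Build SP SPhi_tmulA.

Definition SPhi_tstar s : SP :=
  exist _ (star (val s)) (mem_set (SPhi_star (set_valP s))).

Lemma SPhi_tmulK s : s * SPhi_tstar s * s = s.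
Proof. by apply: val_inj; exact: mulg_star_mulg. Qed.

Lemma SPhi_tmulK' s : SPhi_tstar s * s * SPhi_tstar s = SPhi_tstar s.
Proof. by apply: val_inj; exact: star_mulg_star. Qed.

Lemma SPhi_tstar_unique s t :
  s * t * s = s -> t * s * t = t -> t = SPhi_tstar s.
Proof.
move=> /(congr1 val) h1 /(congr1 val) h2; apply: val_inj.
exact: star_unique h1 h2.
Qed.

HB.instance Definition _ :=
  isInverseSemigroup.Build SP SPhi_tmulK SPhi_tmulK' SPhi_tstar_unique.

Definition alphaA s : set Phi :=
  [set e : Phi | val e * star (val s) * val s = val e].

Lemma alpha_ex s (e : alphaA s) :
  exists f : Phi, starred (val s) (val (val e)) (val f).
Proof.
have [_ Phi0 _] := hPhi.
have Ae : val (val e) * star (val s) * val s = val (val e) := set_valP e.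
have [hs _] := set_valP s.
have [e0|[_ [f [Pf sf]]]] := hs _ (set_valP (val e)).
  by case: (Phi0 _ (set_valP (val e))); rewrite -Ae.
by exists (exist _ f (mem_set Pf)).
Qed.

Definition alpha_val s (e : alphaA s) : Phi := sval (cid (alpha_ex e)).

Definition alphaB s : set Phi := range (@alpha_val s).

Lemma alpha_codP s (e : alphaA s) : alpha_val e \in alphaB s.
Proof. by apply/mem_set; exists e. Qed.

Definition alpha_fun s (e : alphaA s) : alphaB s :=
  exist _ (alpha_val e) (alpha_codP e).

Lemma alpha_bij s : bijective (@alpha_fun s).
Proof.
apply: injsurj_bij; last first.
  by move=> y; have [x _ xy] := set_valP y; exists x; exact: val_inj.
have [PhiE _ _] := hPhi.
have E (e : alphaA s) :
    star (val s) * (val (alpha_val e) * val s) = val (val e).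
  have Ae : val (val e) * star (val s) * val s = val (val e) := set_valP e.
  have [<- _] := svalP (cid (alpha_ex e)).
  rewrite mulgA (idemC (idem_star_mulg _)) ?mulgA //.
  exact/PhiE/set_valP.
move=> x y /(congr1 val) /= xy.
by do 2 apply: val_inj; rewrite -!E xy.
Qed.

Definition alpha s : PB Phi := MkPB (@alpha_bij s).

End Alpha.

Arguments alpha {S Phi} hPhi s.

(* Main.v *)
Require Import Defs.
From mathcomp Require Import all_boot.
From mathcomp Require Import boolp classical_sets.

Set Implicit Arguments.
Unset Strict Implicit.
Unset Printing Implicit Defensive.

Local Open Scope group_scope.

(** The graph of [alpha s] is the relation [starred s e f] between members of
[Phi] ([alpha_rel]). This relation forces [e] into the domain of [alpha s]: for
[s] in [S_Phi] and [e] outside that domain [s * e = 0], and since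
[starred s e f] gives [f = s * e * star s], [f] would be zero.
Composition of partial bijections is composition of graphs, so
the theorem says that [starred (s * t) e g] holds exactly when there is [f] in
[Phi] with [starred t e f] and [starred s f g].

One direction is a computation ([starred_mul]). For the other, [f] has to be
produced: if [t] killed [e], or if [s] killed the image [f] of [e] under [t],
then [s * t] would kill [e] and [g] would be zero. Hence [t] moves [e] to some
[f] and [s] moves [f] to some [g'], and [g' = g] because both equal
[(s * t) * e * star (s * t)]. *)

Section Starred.
Variable S : inverseSemigroup01Type.
Implicit Types s t e f g : S.

Lemma starred_image s e f : starred s e f -> f = s * e * star s.
Proof. by case=> se fss; rewrite se fss. Qed.

Lemma starred_kill s e f : s * e = Defs.zero -> starred s e f -> f = Defs.zero.
Proof. by move=> se0 /starred_image ->; rewrite se0 mul_zerog. Qed.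

Lemma starred_mul s t e f g :
  starred t e f -> starred s f g -> starred (s * t) e g.
Proof.
move=> [te ftt] [sf gss]; split; first by rewrite -mulgA te mulgA sf mulgA.
(* [g * s = s * f] brings the factor [t * star t] next to [f], which
   absorbs it. *)
by rewrite starM !mulgA -sf -(mulgA s) -(mulgA s) ftt sf gss.
Qed.

(** Idempotents commute, so [e * (star s * s) = 0] can be read as
[s * (star s * s) * e = 0]. *)
Lemma mulg_idem_eq0 s e :
  idempotents e -> e * star s * s = Defs.zero -> s * e = Defs.zero.
Proof.
move=> ee es0; rewrite -[in LHS](mulg_star_mulg s) -!mulgA (mulgA (star s)).
by rewrite (idemC (idem_star_mulg s) ee) (mulgA e) es0 mulg_zero.
Qed.

End Starred.

Section AlphaGraph.
Variables (S : inverseSemigroup01Type) (Phi : set S).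
Hypothesis hPhi : equivalent_nonzero_idempotents Phi.
Implicit Types (s : SPhi_type hPhi) (e f : Phi).

Lemma Phi_neq0 e : val e <> Defs.zero.
Proof. by have [_ nz _] := hPhi; exact: nz (set_valP e). Qed.

Lemma Phi_idem e : idempotents (val e).
Proof. by have [PhiE _ _] := hPhi; exact: PhiE (set_valP e). Qed.

(** The dichotomy defining [S(Phi)], with its first alternative put in the form
that passes to products. *)
Lemma SPhi_kill_or_move s e :
  val s * val e = Defs.zero \/ exists f, starred (val s) (val e) (val f).
Proof.
have [hs _] := set_valP s.
have [e0|[_ [f [Pf sf]]]] := hs _ (set_valP e).
  by left; apply: mulg_idem_eq0 e0; exact: Phi_idem.
by right; exists (exist _ f (mem_set Pf)).
Qed.

(** Turns the composition of partial bijections into equations in [S]; the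
image of [e] is pinned down by [starred_image]. *)
Lemma alpha_rel s e f :
  pb_rel (alpha hPhi s) e f <-> starred (val s) (val e) (val f).
Proof.
split=> [ef|sef].
  by have [x [<- <-]] := pb_relP ef; exact: svalP (cid (alpha_ex x)).
have Ae : val e * star (val s) * val s = val e.
  have [hs _] := set_valP s.
  have [e0|[Ae _] //] := hs _ (set_valP e).
  case: (Phi_neq0 (e := f)); apply: starred_kill sef.
  by apply: mulg_idem_eq0 e0; exact: Phi_idem.
have hA : e \in alphaA s by exact/mem_set.
exists hA; apply: val_inj; rewrite (starred_image sef); apply: starred_image.
exact: svalP (cid (alpha_ex (exist _ e hA))).
Qed.

End AlphaGraph.

Theorem proposition2p2 (S : inverseSemigroup01Type) (Phi : set S)
  (hPhi : equivalent_nonzero_idempotents Phi) :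
  {morph alpha hPhi : s t / s * t}.
Proof.
move=> s t; apply: pb_ext => e g; split; last first.
  move=> /pb_mul_rel[f /alpha_rel tef /alpha_rel sfg].
  by apply/alpha_rel; exact: starred_mul tef sfg.
move=> /alpha_rel steg.
have ste_neq0 : val s * val t * val e <> Defs.zero.
  move=> ste0; apply: (@Phi_neq0 _ _ hPhi g).
  exact: starred_kill ste0 steg.
have [te0|[f tef]] := SPhi_kill_or_move t e.
  by case: ste_neq0; rewrite -mulgA te0 mulg_zero.
have [sf0|[g' sfg']] := SPhi_kill_or_move s f.
  by case: ste_neq0; rewrite -mulgA (proj1 tef) mulgA sf0 mul_zerog.
have <- : g' = g.
  apply: val_inj; rewrite (starred_image steg).
  exact: starred_image (starred_mul tef sfg').
by apply/pb_mul_rel; exists f; exact/alpha_rel.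
Qed.
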